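(* Let $w_n(a)=w_n(a,b,c,d)$, $n\ge 0$, be the moments of the Wilson polynomials. Then, as formal power series in $t$, $$\sum_{n\geq 0}w_n(a)t^n=\sum_{n\geq 0}\frac{(a+b)_n(a+c)_n(a+d)_n\,t^{n}}{(a+b+c+d)_n\prod_{l=0}^n(1+(a+l)^2t)}=\frac{1}{1+a^2t}\;{}_4F_3\left(\begin{array}{c}a+b,\ a+c,\ a+d,\ 1\\ a+b+c+d,\ a+1+i/\sqrt{t},\ a+1-i/\sqrt{t}\end{array};1\right),$$ where the ${}_4F_3$ is understood term by term (its $n$th term is a formal power series in $t$ divisible by $t^n$).
   Context: $(x)_n=x(x+1)\cdots(x+n-1)$, $(x)_0=1$, and ${}_{r}F_{s}$ denotes the generalized hypergeometric series; $i^2=-1$. The moments $w_n(a)=w_n(a,b,c,d)$ of the Wilson polynomials are defined (e.g. for $a,b,c,d>0$) by $$\frac{1}{2\pi}\int_0^\infty\left|\frac{\Gamma(a+ix)\Gamma(b+ix)\Gamma(c+ix)\Gamma(d+ix)}{\Gamma(2ix)}\right|^2x^{2n}dx=w_{n}(a)\frac{\Gamma(a+b)\Gamma(a+c)\Gamma(a+d)\Gamma(b+c)\Gamma(b+d)\Gamma(c+d)}{\Gamma(a+b+c+d)}.$$ They satisfy $w_0(a)=1$ and $w_{n+1}(a)=\frac{(a+b)(a+c)(a+d)}{a+b+c+d}\,w_n(a+1)-a^2w_n(a)$ for $n\ge0$ (where $w_n(a+1)=w_n(a+1,b,c,d)$). In general $w_n(a,b,c,d)$ is understood as the rational function of the indeterminates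 $a,b,c,d$ determined by this initial value and recurrence. *)

(* Defs.v *)
From HB Require Import structures.
From mathcomp Require Import all_boot all_order all_algebra.
From mathcomp Require Import boolp.
From mathcomp Require Import mpoly.

Set Implicit Arguments.
Unset Strict Implicit.
Unset Printing Implicit Defensive.

Import GRing.Theory.
Local Open Scope ring_scope.

(* Formal power series in one variable, given by their coefficient sequence.  *)
Record fps (F : fieldType) := Fps { fps_coef :> nat -> F }.

Section FpsRing.
Variable F : fieldType.
Implicit Types f g h : fps F.

Lemma fpsP f g : f =1 g -> f = g.
Proof. by case: f g => [f] [g] /= /funext ->. Qed.

HB.instance Definition _ := gen_eqMixin (fps F).
HB.instance Definition _ := gen_choiceMixin (fps F).

Definition fpsC (c : F) : fps F := Fps (fun n => if n is 0 then c else 0).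
Definition fpsX : fps F := Fps (fun n => (n == 1)%N%:R).
Definition fps_add f g : fps F := Fps (fun n => f n + g n).
Definition fps_opp f : fps F := Fps (fun n => - f n).
Definition fps_mul f g : fps F :=
  Fps (fun n => \sum_(i < n.+1) f i * g (n - i)%N).

Fact fps_addA : associative fps_add.
Proof. by move=> f g h; apply: fpsP => n /=; rewrite addrA. Qed.
Fact fps_addC : commutative fps_add.
Proof. by move=> f g; apply: fpsP => n /=; rewrite addrC. Qed.
Fact fps_add0 : left_id (fpsC 0) fps_add.
Proof. by move=> f; apply: fpsP => -[|n] /=; rewrite add0r. Qed.
Fact fps_addN : left_inverse (fpsC 0) fps_opp fps_add.
Proof. by move=> f; apply: fpsP => -[|n] /=; rewrite addNr. Qed.

HB.instance Definition _ :=
  GRing.isZmodule.Build (fps F) fps_addA fps_addC fps_add0 fps_addN.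

Let trunc N f : {poly F} := \poly_(i < N) f i.

Let fps_mulE N f g n : (n < N)%N -> fps_mul f g n = (trunc N f * trunc N g)`_n.
Proof.
move=> nN; rewrite coefM /=; apply: eq_bigr => i _.
by rewrite !coef_poly !(leq_ltn_trans _ nN) ?leq_subr // -ltnS.
Qed.

Fact fps_mulC : commutative fps_mul.
Proof.
by move=> f g; apply: fpsP => n; rewrite !(@fps_mulE n.+1) // mulrC.
Qed.

Fact fps_mulA : associative fps_mul.
Proof.
move=> f g h; apply: fpsP => n; pose T := trunc n.+1.
have E1 k l : (k <= n)%N -> (T (fps_mul l h))`_k = (T l * T h)`_k.
  by move=> kn; rewrite coef_poly ltnS kn (@fps_mulE n.+1).
have E2 k l : (k <= n)%N -> (T (fps_mul f l))`_k = (T f * T l)`_k.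
  by move=> kn; rewrite coef_poly ltnS kn (@fps_mulE n.+1).
rewrite !(@fps_mulE n.+1) // -!/(T _).
transitivity (T f * T g * T h)`_n.
  rewrite -mulrA !coefM; apply: eq_bigr => i _.
  by rewrite E1 // leq_subr.
rewrite !coefM; apply: eq_bigr => i _; congr (_ * _).
by rewrite E2 // -ltnS.
Qed.

Fact fps_mul1 : left_id (fpsC 1) fps_mul.
Proof.
move=> f; apply: fpsP => n /=; rewrite big_ord_recl /= mul1r subn0.
by rewrite big1 ?addr0 // => i _; rewrite mul0r.
Qed.

Fact fps_mulDl : left_distributive fps_mul (@GRing.add (fps F)).
Proof.
move=> f g h; apply: fpsP => n /=; rewrite -big_split /=.
by apply: eq_bigr => i _; rewrite mulrDl.
Qed.

Fact fps_one_neq0 : fpsC 1 != 0.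
Proof. by apply/eqP => /(congr1 (fun f : fps F => f 0%N)) /eqP; rewrite /= oner_eq0. Qed.

HB.instance Definition _ := GRing.Zmodule_isComNzRing.Build (fps F)
  fps_mulA fps_mulC fps_mul1 fps_mulDl fps_one_neq0.

(* [fps_invs f n] lists the first n coefficients of the inverse of f.         *)
Fixpoint fps_invs f n : seq F :=
  if n is m.+1 then
    let s := fps_invs f m in
    rcons s ((f 0%N)^-1 * ((m == 0)%N%:R - \sum_(k < m) f k.+1 * s`_(m - k.+1)))
  else [::].

Definition fps_unit f := f 0%N != 0.
Definition fps_inv f : fps F :=
  if fps_unit f then Fps (fun n => (fps_invs f n.+1)`_n) else f.

Let size_invs f n : size (fps_invs f n) = n.
Proof. by elim: n => //= n IH; rewrite size_rcons IH. Qed.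

Let nth_invs f n k : (k < n)%N -> (fps_invs f n)`_k = (fps_invs f k.+1)`_k.
Proof.
elim: n => // n IH; rewrite ltnS leq_eqVlt => /predU1P[-> //|kn].
by rewrite -(IH kn) [in LHS]/= nth_rcons size_invs kn.
Qed.

Fact fps_mulV : {in fps_unit, left_inverse 1 fps_inv *%R}.
Proof.
move=> f; rewrite -topredE /= => f0.
rewrite mulrC /fps_inv f0; apply: fpsP => n.
rewrite [LHS]big_ord_recl subn0 [X in f ord0 * X]/= nth_rcons size_invs.
rewrite ltnn eqxx mulrA mulfV // mul1r.
rewrite [X in _ + X](_ : _ = \sum_(k < n) f k.+1 * (fps_invs f n)`_(n - k.+1)).
  by rewrite subrK; case: n.
apply: eq_bigr => i _ /=; congr (_ * _).
have lt_n : (n - i.+1 < n)%N by rewrite ltn_subrL (leq_trans _ (ltn_ord i)).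
by rewrite [RHS](nth_invs _ lt_n).
Qed.

Fact fps_unitP f g : g * f = 1 -> fps_unit f.
Proof.
move=> /(congr1 (fun f : fps F => f 0%N)) /=; rewrite big_ord1 /= => E.
by apply/eqP => f0; move/eqP: E; rewrite f0 mulr0 eq_sym oner_eq0.
Qed.

Fact fps_inv_out : {in [predC fps_unit], fps_inv =1 id}.
Proof. by move=> f; rewrite inE /fps_inv -topredE /= => /negPf ->. Qed.

HB.instance Definition _ := GRing.ComNzRing_hasMulInverse.Build (fps F)
  fps_mulV fps_unitP fps_inv_out.

Let fps_lead f : f != 0 -> exists2 i, f i != 0 & forall j, (j < i)%N -> f j = 0.
Proof.
move=> nz; have ex : exists i, f i != 0.
  apply: contrapT => nex; case/eqP: nz; apply: fpsP => i.
  have [->|fi] := eqVneq (f i) 0; first by case: i.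
  by case: nex; exists i.
case: (ex_minnP ex) => i fi min_i; exists i => // j lt_ji.
by apply/eqP; apply: contraLR lt_ji => /min_i; rewrite -leqNgt.
Qed.

Fact fps_idomain : GRing.integral_domain_axiom (fps F).
Proof.
move=> f g fg0; apply/norP => -[/fps_lead[i fi Hi] /fps_lead[j gj Hj]].
move/(congr1 (fun f : fps F => f (i + j)%N)): fg0 => /=.
have ii : (i < (i + j).+1)%N by rewrite ltnS leq_addr.
rewrite (bigD1 (Ordinal ii)) //= big1 => [|k ki].
  rewrite addr0 addKn => E; have: f i * g j = 0 by rewrite E; case: (i + j)%N.
  by move/eqP; rewrite mulf_eq0 (negPf fi) (negPf gj).
have [lt|ge] := ltnP k i; first by rewrite Hi ?mul0r.
have lt_ik : (i < k)%N.
  by rewrite ltn_neqAle ge andbT eq_sym; apply: contraNneq ki => E; apply/eqP/val_inj.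
have lt_j : (i + j - k < j)%N.
  by rewrite ltn_subLR ?ltn_add2r // -ltnS.
by rewrite (Hj _ lt_j) mulr0.
Qed.

HB.instance Definition _ :=
  GRing.ComUnitRing_isIntegral.Build (fps F) fps_idomain.

End FpsRing.

Notation "''t'" := (fpsX _) : ring_scope.

(* S is the sum of the series of the u_n for the t-adic topology.             *)
Definition fps_has_sum (F : fieldType) (u : nat -> fps F) (S : fps F) :=
  forall k, exists N, forall m, (N <= m)%N -> (\sum_(n < m) u n) k = S k.

(* The field F((s)) of formal Laurent series, with s := laurentX F.  A power  *)
(* series in t is seen inside it through t = s ^ 2, so that s is a square     *)
(* root of t.                                                                 *)
Notation laurent F := {fraction (fps F)}.

Definition laurentX (F : fieldType) : laurent F := FracField.tofrac (fpsX F).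
Definition laurentC (F : fieldType) (c : F) : laurent F :=
  FracField.tofrac (fpsC c).
Definition laurent_sq (F : fieldType) (f : fps F) : laurent F :=
  FracField.tofrac (Fps (fun n => if odd n then 0 else f n./2)).

Definition pochhammer (R : pzRingType) (x : R) (n : nat) : R :=
  \prod_(l < n) (x + l%:R).

(* n-th term of the hypergeometric series with upper parameters [us], lower   *)
(* parameters [ls] and argument z.                                            *)
Definition hypergeom_term (L : fieldType) (us ls : seq L) (z : L) (n : nat) : L :=
  (\prod_(x <- us) pochhammer x n) / (\prod_(x <- ls) pochhammer x n)
    * (z ^+ n / (n`!)%:R).

Notation ratfun C n := {fraction {mpoly C[n]}}.

Section RationalFunctions.
Variables (C : fieldType) (n : nat).

Definition ratfun_var (i : 'I_n) : ratfun C n :=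
  FracField.tofrac ('X_i : {mpoly C[n]}).
Definition ratfun_const (c : C) : ratfun C n :=
  FracField.tofrac (c%:MP : {mpoly C[n]}).

(* x(v_0, ..., v_(n-1)), computed on a fraction representing x; meaningful    *)
(* when the v_i are algebraically independent over C, so that no nonzero      *)
(* denominator vanishes.                                                      *)
Definition ratfun_subst (v : n.-tuple (ratfun C n)) (x : ratfun C n) : ratfun C n :=
  let r : {ratio {mpoly C[n]}} := repr x in
  mmap ratfun_const (tnth v) \n_r / mmap ratfun_const (tnth v) \d_r.

End RationalFunctions.

Section WilsonMoments.
Variable C : fieldType.

Definition Wa : ratfun C 4 := ratfun_var C (inord 0%N).
Definition Wb : ratfun C 4 := ratfun_var C (inord 1%N).
Definition Wc : ratfun C 4 := ratfun_var C (inord 2%N).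
Definition Wd : ratfun C 4 := ratfun_var C (inord 3%N).

Fixpoint wilson_moment (n : nat) : ratfun C 4 :=
  if n is m.+1 then
    (Wa + Wb) * (Wa + Wc) * (Wa + Wd) / (Wa + Wb + Wc + Wd)
      * ratfun_subst [tuple Wa + 1; Wb; Wc; Wd] (wilson_moment m)
    - Wa ^+ 2 * wilson_moment m
  else 1.

End WilsonMoments.

(* Main.v *)
From HB Require Import structures.
Require Import Defs.
From mathcomp Require Import all_boot all_order all_algebra.
From mathcomp Require Import ring.
From mathcomp Require Import mpoly.

Set Implicit Arguments.
Unset Strict Implicit.
Unset Printing Implicit Defensive.

Import GRing.Theory.
Local Open Scope ring_scope.

(** Why the theorem holds. Write T_n for the n-th term of the first series,
    W for the generating function of the moments, sigma for the substitution
    a -> a + 1 acting on coefficients, s = a + b + c + d, and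
    K = (a + b)(a + c)(a + d) / s. The recurrence of the moments says
      (1 + a^2 t) W = 1 + K t sigma(W),
    while peeling off the first factor of each Pochhammer symbol and of each
    product gives
      T_0 = 1 / (1 + a^2 t),   T_(n+1) = K t / (1 + a^2 t) sigma(T_n).
    Hence the remainders R_m = W - (T_0 + ... + T_(m-1)) satisfy
      R_(m+1) = K t / (1 + a^2 t) sigma(R_m),
    so t^m divides R_m ([wilson_gf_remainder]). This is convergence to W.

    This argument uses of sigma only that it is a ring endomorphism of the
    field of coefficients with the right values on a, b, c, d. It is therefore
    carried out over an arbitrary field, and the concrete substitution in
    rational functions is treated separately: a translation of the variables is
    invertible on polynomials, so no denominator is sent to 0
    ([translation_subst_neq0]), and the quotient of the images does not depend
    on the fraction representing a rational function ([ratfun_subst_frac]).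

    For the hypergeometric form, with s' a square root of t, the factors of the
    two conjugate lower parameters combine in pairs to
      (a + 1 + l + i / s')(a + 1 + l - i / s') = (a + 1 + l)^2 + 1 / t,
    that is, to the factors 1 + (a + l + 1)^2 t divided by t
    ([conjugate_pochhammer]); the upper parameter 1 cancels the n!, and what
    remains is (1 + a^2 t) T_n ([wilson_hyp_hypergeom], [wilson_hypE]). *)

(** * Substitution in rational functions *)

Lemma fracE (R : idomainType) (x : {fraction R}) :
  x = FracField.tofrac \n_(repr x) / FracField.tofrac \d_(repr x).
Proof.
rewrite -{1}[x]generic_quotient.reprK; set r := generic_quotient.repr x.
rewrite -[RHS]/(FracField.mul _ (FracField.inv _)); unlock FracField.tofrac.
rewrite -FracField.pi_inv -FracField.pi_mul; congr (generic_quotient.pi _ _).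
rewrite /FracField.mulf /FracField.invf !numden_Ratio ?oner_neq0 ?denom_ratioP //.
by rewrite mulr1 mul1r FracField.Ratio_numden.
Qed.

Lemma frac_ex (R : idomainType) (x : {fraction R}) :
  exists p q : R, q != 0 /\ x = FracField.tofrac p / FracField.tofrac q.
Proof.
by exists \n_(repr x), \d_(repr x); split; [exact: denom_ratioP | exact: fracE].
Qed.

Lemma mpoly_rmorph_ext (n : nat) (R : comNzRingType) (S : comNzRingType)
    (f g : {rmorphism {mpoly R[n]} -> S}) :
  (forall c, f c%:MP = g c%:MP) -> (forall i, f 'X_i = g 'X_i) -> f =1 g.
Proof.
move=> fgC fgX p; rewrite [p]mpolyE !rmorph_sum; apply: eq_bigr => m _.
rewrite -mul_mpolyC !rmorphM fgC mpolyXE_id !rmorph_prod; congr (_ * _).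
by apply: eq_bigr => i _; rewrite !rmorphXn fgX.
Qed.

Section Substitution.
Variables (C : fieldType) (n : nat) (v : n.-tuple (ratfun C n)).

HB.instance Definition _ := GRing.RMorphism.copy (@ratfun_const C n)
  (@FracField.tofrac {mpoly C[n]} \o mpolyC n (R:=C)).

Local Notation subst_mpoly := (mmap (@ratfun_const C n) (tnth v)).

(* Holds as soon as the v_i are algebraically independent over C. *)
Hypothesis subst_neq0 : forall p : {mpoly C[n]}, p != 0 -> subst_mpoly p != 0.

(** Substitution is defined on a chosen fraction; it can be computed on any
    other one, because two fractions are equal when their cross products are,
    and substitution in polynomials is multiplicative. *)
Lemma ratfun_subst_frac (p q : {mpoly C[n]}) : q != 0 ->
  ratfun_subst v (FracField.tofrac p / FracField.tofrac q)
    = subst_mpoly p / subst_mpoly q.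
Proof.
move=> q0; set x := (x in ratfun_subst v x); rewrite /ratfun_subst; set r := repr x.
have d0 : \d_r != 0 by exact: denom_ratioP.
apply/eqP; rewrite eqr_div ?subst_neq0 // -!rmorphM; apply/eqP; congr mmap.
apply/eqP; rewrite -tofrac_eq !rmorphM -eqr_div ?tofrac_eq0 //; apply/eqP.
exact/esym/fracE.
Qed.

Lemma ratfun_subst_monoid_morphism : monoid_morphism (ratfun_subst v).
Proof.
split=> [|x y].
  have := @ratfun_subst_frac 1 1 (oner_neq0 _).
  by rewrite !rmorph1 divr1.
have [p [q [q0 ->]]] := frac_ex x; have [p' [q' [q0' ->]]] := frac_ex y.
by rewrite mulf_div -!rmorphM !ratfun_subst_frac ?mulf_neq0 // mulf_div !rmorphM.
Qed.

Lemma ratfun_subst_zmod_morphism : zmod_morphism (ratfun_subst v).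
Proof.
move=> x y.
have [p [q [q0 ->]]] := frac_ex x; have [p' [q' [q0' ->]]] := frac_ex y.
rewrite -mulNr addf_div ?tofrac_eq0 // -rmorphN -!rmorphM -rmorphD.
rewrite !ratfun_subst_frac ?mulf_neq0 //.
by rewrite -[in RHS]mulNr addf_div ?subst_neq0 // rmorphD !rmorphM rmorphN.
Qed.

Lemma ratfun_subst_var i : ratfun_subst v (ratfun_var C i) = tnth v i.
Proof.
have := @ratfun_subst_frac 'X_i 1 (oner_neq0 _).
by rewrite !rmorph1 !divr1 mmapX mmap1U.
Qed.
End Substitution.

(** Substituting X_i + s_i for X_i is injective on polynomials, as substituting
    X_i - s_i afterwards gives the polynomial back. *)
Lemma translation_subst_neq0 (C : fieldType) (n : nat) (s : 'I_n -> C)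
    (v : n.-tuple (ratfun C n)) :
  (forall i, tnth v i = ratfun_var C i + ratfun_const n (s i)) ->
  forall p : {mpoly C[n]}, p != 0 -> mmap (@ratfun_const C n) (tnth v) p != 0.
Proof.
move=> vE p.
pose tr (s : 'I_n -> C) := [tuple 'X_i + (s i)%:MP | i < n] : n.-tuple {mpoly C[n]}.
have -> : mmap (@ratfun_const C n) (tnth v) p
    = FracField.tofrac (p \mPo tr s).
  move: p; apply: (@mpoly_rmorph_ext n C _ _
    (@FracField.tofrac _ \o comp_mpoly (tr s))) => [c|i] /=.
    by rewrite mmapC comp_mpolyC.
  by rewrite mmapX mmap1U comp_mpolyXU -tnth_nth tnth_mktuple vE rmorphD.
rewrite tofrac_eq0; apply: contraNneq => ps0.
suff <- : (p \mPo tr s) \mPo tr (fun i => - s i) = p by rewrite ps0 comp_mpoly0.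
move: p {ps0}; apply: (@mpoly_rmorph_ext n C _
  (comp_mpoly (tr (fun i => - s i)) \o comp_mpoly (tr s)) idfun) => [c|i] /=.
  by rewrite !comp_mpolyC.
rewrite comp_mpolyXU -tnth_nth tnth_mktuple comp_mpolyD comp_mpolyC.
by rewrite comp_mpolyXU -tnth_nth tnth_mktuple mpolyCN subrK.
Qed.

(** * Ring morphisms between power series and Laurent series *)

Section FpsMorphisms.
Variable F : fieldType.
Implicit Types f g : fps F.

Lemma fpsCM_coef c f k : (fpsC c * f) k = c * f k.
Proof.
rewrite [LHS]big_ord_recl /= subn0 big1 ?addr0 // => i _.
by rewrite mul0r.
Qed.

Lemma fpsXM_coef f k : ('t * f) k = if k is k'.+1 then f k' else 0.
Proof.
case: k => [|k]; first by rewrite [LHS]big_ord1 /= mul0r.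
rewrite [LHS]big_ord_recl mul0r add0r big_ord_recl /= mul1r subSS subn0.
by rewrite big1 ?addr0 // => i _; rewrite mul0r.
Qed.

Lemma fpsXnM_coef n f k : (k < n)%N -> ('t ^+ n * f) k = 0.
Proof.
elim: n k => // n IH [|k] kn; rewrite exprS -mulrA fpsXM_coef //.
exact: IH.
Qed.

Fact fpsC_zmod_morphism : zmod_morphism (@fpsC F).
Proof. by move=> x y; apply: fpsP => -[|k] //=; rewrite subrr. Qed.

Fact fpsC_monoid_morphism : monoid_morphism (@fpsC F).
Proof.
by split=> // x y; apply: fpsP => k; rewrite fpsCM_coef; case: k => //=; rewrite mulr0.
Qed.

HB.instance Definition _ :=
  GRing.isZmodMorphism.Build F (fps F) (@fpsC F) fpsC_zmod_morphism.
HB.instance Definition _ :=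
  GRing.isMonoidMorphism.Build F (fps F) (@fpsC F) fpsC_monoid_morphism.

Definition fps_map (sigma : F -> F) f := Fps (fun k => sigma (f k)).

Section Map.
Variable sigma : {rmorphism F -> F}.

Fact fps_map_zmod_morphism : zmod_morphism (fps_map sigma).
Proof. by move=> f g; apply: fpsP => k /=; rewrite rmorphB. Qed.

Fact fps_map_monoid_morphism : monoid_morphism (fps_map sigma).
Proof.
split=> [|f g]; apply: fpsP => k /=; first by case: k => [|k]; rewrite ?rmorph1 ?rmorph0.
by rewrite rmorph_sum; apply: eq_bigr => i _; rewrite rmorphM.
Qed.

HB.instance Definition _ := GRing.isZmodMorphism.Build (fps F) (fps F)
  (fps_map sigma) fps_map_zmod_morphism.
HB.instance Definition _ := GRing.isMonoidMorphism.Build (fps F) (fps F)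
  (fps_map sigma) fps_map_monoid_morphism.

Lemma fps_mapC c : fps_map sigma (fpsC c) = fpsC (sigma c).
Proof. by apply: fpsP => -[|k] //=; rewrite rmorph0. Qed.

Lemma fps_mapX : fps_map sigma 't = 't.
Proof. by apply: fpsP => k /=; rewrite rmorph_nat. Qed.
End Map.

(** The substitution t -> t ^ 2, the part of [laurent_sq] that stays inside
    power series. *)
Definition fps_sq f : fps F := Fps (fun k => if odd k then 0 else f k./2).

Fact fps_sq_zmod_morphism : zmod_morphism fps_sq.
Proof. by move=> f g; apply: fpsP => k /=; case: ifP => // _; rewrite subrr. Qed.

Lemma sum_even_indices (G : nat -> F) m : (forall j, G j.*2.+1 = 0) ->
  \sum_(i < m.*2.+1) G i = \sum_(j < m.+1) G j.*2.
Proof.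
move=> G0; elim: m => [|m IH]; first by rewrite !big_ord1.
rewrite doubleS [RHS]big_ord_recr [LHS]big_ord_recr [in LHS]big_ord_recr /=.
by rewrite IH G0 addr0 doubleS.
Qed.

Fact fps_sq_monoid_morphism : monoid_morphism fps_sq.
Proof.
split=> [|f g]; apply: fpsP => k /=.
  by case: k => [|[|k]] //=; case: ifP.
have [odd_k|even_k] := ifPn.
  rewrite big1 // => i _; case: ifPn => odd_i; first by rewrite mul0r.
  by rewrite oddB -1?ltnS // odd_k (negPf odd_i) mulr0.
rewrite -[k]odd_double_half (negPf even_k) add0n doubleK; set m := k./2.
rewrite (@sum_even_indices (fun i => (if odd i then 0 else f i./2) *
  (if odd (m.*2 - i) then 0 else g (m.*2 - i)./2))) => [|j]; last first.
  by rewrite /= odd_double mul0r.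
by apply: eq_bigr => j _; rewrite -doubleB !odd_double !doubleK.
Qed.

HB.instance Definition _ := GRing.isZmodMorphism.Build (fps F) (fps F)
  fps_sq fps_sq_zmod_morphism.
HB.instance Definition _ := GRing.isMonoidMorphism.Build (fps F) (fps F)
  fps_sq fps_sq_monoid_morphism.

HB.instance Definition _ := GRing.RMorphism.copy (@laurent_sq F)
  (@FracField.tofrac (fps F) \o fps_sq).
HB.instance Definition _ := GRing.RMorphism.copy (@laurentC F)
  (@FracField.tofrac (fps F) \o @fpsC F).

Lemma laurent_sqC (c : F) : laurent_sq (fpsC c) = laurentC c.
Proof.
by congr FracField.tofrac; apply: fpsP => -[|[|k]] //=; case: ifP.
Qed.

Lemma laurent_sqX : laurent_sq 't = laurentX F ^+ 2.
Proof.
rewrite -rmorphXn; congr FracField.tofrac; apply: fpsP => k.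
rewrite expr2 fpsXM_coef /=; case: k => [|[|[|[|k]]]] //=.
by case: ifP.
Qed.

Lemma laurentX_neq0 : laurentX F != 0.
Proof.
rewrite tofrac_eq0; apply/eqP => /(congr1 (fun f : fps F => f 1%N)) /eqP.
by rewrite oner_eq0.
Qed.

(** Divisibility of the remainders by growing powers of t is easier to
    propagate than convergence of each coefficient: it survives multiplication
    by a series and the application of a morphism to the coefficients. *)
Lemma fps_has_sum_dvd (u : nat -> fps F) S :
  (forall m, exists g, S - \sum_(n < m) u n = 't ^+ m * g) -> fps_has_sum u S.
Proof.
move=> dvd k; exists k.+1 => m km; have [g Eg] := dvd m.
have: (S - \sum_(n < m) u n) k = 0 by rewrite Eg fpsXnM_coef.
by move/eqP; rewrite subr_eq0 => /eqP.
Qed.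
End FpsMorphisms.

(** * Pochhammer symbols *)

Section Pochhammer.
Variable R : comPzRingType.

Lemma pochhammerSl (x : R) n : pochhammer x n.+1 = x * pochhammer (x + 1) n.
Proof.
rewrite /pochhammer big_ord_recl addr0; congr (_ * _).
by apply: eq_bigr => i _; rewrite /= -addrA nat1r.
Qed.

Lemma pochhammer1 n : pochhammer 1 n = n`!%:R :> R.
Proof.
elim: n => [|n IH]; first by rewrite /pochhammer big_ord0.
by rewrite /pochhammer big_ord_recr -/(pochhammer _ _) /= IH nat1r -natrM factS mulnC.
Qed.
End Pochhammer.

Lemma rmorph_pochhammer (R S : comPzRingType) (f : {rmorphism R -> S}) x n :
  f (pochhammer x n) = pochhammer (f x) n.
Proof.
rewrite rmorph_prod; apply: eq_bigr => l _.
by rewrite rmorphD rmorph_nat.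
Qed.

Lemma pochhammer_neq0 (R : idomainType) (x : R) n :
  (forall l : nat, x + l%:R != 0) -> pochhammer x n != 0.
Proof. by move=> x_neq0; apply/prodf_neq0 => l _. Qed.

(** * The two series over an arbitrary field *)

(** With j = i and x = sqrt t: each factor of one lower parameter of the
    hypergeometric series, times its conjugate, is rational in t. *)
Lemma conjugate_factors (L : fieldType) (x y j : L) : x != 0 -> j ^+ 2 = -1 ->
  x ^+ 2 * ((y + j / x) * (y - j / x)) = 1 + y ^+ 2 * x ^+ 2.
Proof.
move=> x0 j2; rewrite [(y + _) * _]mulrC -subr_sqr expr_div_n j2.
by rewrite mulN1r opprK mulrDr mulfV ?expf_neq0 // addrC mulrC.
Qed.

Section WilsonSeries.
Variables (F : fieldType) (a b c d : F).
Local Notation s := (a + b + c + d).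

Definition wilson_factor (x : F) : fps F := 1 + fpsC (x ^+ 2) * 't.
Definition wilson_num n : fps F :=
  fpsC (pochhammer (a + b) n * pochhammer (a + c) n * pochhammer (a + d) n)
    * 't ^+ n.
Definition wilson_den n : fps F :=
  fpsC (pochhammer s n) * \prod_(0 <= l < n.+1) wilson_factor (a + l%:R).

Lemma wilson_factor_unit x : wilson_factor x \is a GRing.unit.
Proof.
change (1 + (fpsC (x ^+ 2) * 't : fps F) 0%N != 0).
by rewrite fpsCM_coef mulr0 addr0 oner_eq0.
Qed.

Lemma fpsC_unit (x : F) : x != 0 -> fpsC x \is a GRing.unit.
Proof. by []. Qed.

(* Inverses of non-units are not meaningful in the ring of power series, so the
   denominators have to be units before anything can be simplified. *)
Hypothesis s_neq0 : forall l : nat, s + l%:R != 0.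

Lemma wilson_den_unit n : wilson_den n \is a GRing.unit.
Proof.
rewrite unitrM fpsC_unit ?pochhammer_neq0 //=.
by apply: rpred_prod => l _; exact: wilson_factor_unit.
Qed.

(* sigma stands for the substitution a -> a + 1. *)
Section Recurrence.
Variable sigma : {rmorphism F -> F}.
Hypotheses (sigma_a : sigma a = a + 1) (sigma_b : sigma b = b)
  (sigma_c : sigma c = c) (sigma_d : sigma d = d).

Lemma wilson_num_rec n : wilson_num n.+1 =
  fpsC ((a + b) * (a + c) * (a + d)) * 't * fps_map sigma (wilson_num n).
Proof.
have shift x : sigma x = x ->
    sigma (pochhammer (a + x) n) = pochhammer (a + x + 1) n.
  by move=> sx; rewrite rmorph_pochhammer rmorphD /= sigma_a sx addrAC.
rewrite /wilson_num [fps_map _ _]rmorphM /= [fps_map _ (_ ^+ _)]rmorphXn /=.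
rewrite fps_mapX fps_mapC !(rmorphM sigma) /= !shift // !pochhammerSl exprS.
by rewrite !rmorphM; ring.
Qed.

Lemma wilson_den_rec n : wilson_den n.+1 =
  fpsC s * wilson_factor a * fps_map sigma (wilson_den n).
Proof.
have shift : sigma (pochhammer s n) = pochhammer (s + 1) n.
  rewrite rmorph_pochhammer !rmorphD /= sigma_a sigma_b sigma_c sigma_d.
  by rewrite !(addrAC _ 1).
rewrite /wilson_den [fps_map _ _]rmorphM /= fps_mapC shift pochhammerSl.
rewrite [fps_map _ (\prod_(_ <= _ < _) _)]rmorph_prod big_nat_recl // addr0.
rewrite [X in _ * _ * (_ * X)](eq_bigr (fun l => wilson_factor (a + l.+1%:R))).
  by rewrite rmorphM; ring.
move=> l _; rewrite /wilson_factor rmorphD rmorph1 rmorphM /= fps_mapC fps_mapX.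
by rewrite (rmorphXn sigma) (rmorphD sigma) rmorph_nat sigma_a -addrA nat1r.
Qed.

Lemma wilson_term_rec n : wilson_num n.+1 / wilson_den n.+1 =
  fpsC ((a + b) * (a + c) * (a + d) / s) * 't / wilson_factor a
    * fps_map sigma (wilson_num n / wilson_den n).
Proof.
have s0 : s != 0 by have := s_neq0 0; rewrite addr0.
rewrite wilson_num_rec wilson_den_rec.
rewrite [fps_map _ (_ / _)]rmorph_div ?wilson_den_unit //=.
rewrite [fpsC (_ / s)]rmorph_div ?unitfE //=.
rewrite !invrM ?unitrM ?fpsC_unit ?wilson_factor_unit ?rmorph_unit ?wilson_den_unit //.
ring.
Qed.

Variable w : nat -> F.
Hypotheses (w0 : w 0 = 1)
  (wS : forall n, w n.+1 =
    (a + b) * (a + c) * (a + d) / s * sigma (w n) - a ^+ 2 * w n).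

(** The recurrence of the moments in the form
    (1 + a^2 t) W = 1 + K t sigma(W), divided by 1 + a^2 t. *)
Lemma wilson_gf_rec : Fps w = (wilson_factor a)^-1
  + fpsC ((a + b) * (a + c) * (a + d) / s) * 't / wilson_factor a
    * fps_map sigma (Fps w).
Proof.
set k := _ / s.
have E : wilson_factor a * Fps w = 1 + fpsC k * 't * fps_map sigma (Fps w).
  have -> : wilson_factor a * Fps w = Fps w + 't * (fpsC (a ^+ 2) * Fps w).
    by rewrite /wilson_factor; ring.
  rewrite -mulrA [fpsC k * _]mulrCA.
  apply: fpsP => n.
  change (w n + ('t * (fpsC (a ^+ 2) * Fps w)) n
    = (1 : fps F) n + ('t * (fpsC k * fps_map sigma (Fps w))) n).
  rewrite !fpsXM_coef; case: n => [|n]; first by rewrite w0.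
  by rewrite !fpsCM_coef wS /= add0r subrK.
apply: (mulrI (wilson_factor_unit a)); rewrite E mulrDr divrr ?wilson_factor_unit //.
by rewrite mulrA mulrCA divrr ?wilson_factor_unit // mulr1.
Qed.

(** W and the terms satisfy the same affine recurrence, so that its constant
    part, which is the term of index 0, drops out of the remainders; passing
    from one remainder to the next then costs a factor t. *)
Lemma wilson_gf_remainder m : exists g,
  Fps w - \sum_(n < m) wilson_num n / wilson_den n = 't ^+ m * g.
Proof.
elim: m => [|m [g IH]]; first by exists (Fps w); rewrite big_ord0 subr0 mul1r.
set k := (a + b) * (a + c) * (a + d) / s.
exists (fpsC k / wilson_factor a * fps_map sigma g).
rewrite big_ord_recl.
under eq_bigr do rewrite wilson_term_rec.
rewrite -mulr_sumr -rmorph_sum {1}wilson_gf_rec.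
have -> : wilson_num 0 / wilson_den 0 = (wilson_factor a)^-1.
  rewrite /wilson_num /wilson_den /pochhammer !big_ord0 big_nat1 addr0 !mulr1.
  by rewrite rmorph1 !mul1r.
rewrite opprD addrACA subrr add0r -mulrBr -rmorphB IH /=.
rewrite [fps_map _ (_ * _)]rmorphM /= [fps_map _ (_ ^+ _)]rmorphXn /=.
by rewrite fps_mapX exprS -/k; ring.
Qed.

End Recurrence.

(** The hypergeometric term as a power series in t, before it is compared with
    its expression in sqrt t. *)
Definition wilson_hyp n : fps F :=
  wilson_num n / (fpsC (pochhammer s n) * \prod_(l < n) wilson_factor (a + l.+1%:R)).

Lemma wilson_hyp_dvd n : exists g, wilson_hyp n = 't ^+ n * g.
Proof.
rewrite /wilson_hyp /wilson_num; set p := fpsC _; set q := _ * \prod_(_ < _) _.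
by exists (p / q); rewrite mulrA [_ * p]mulrC.
Qed.

Lemma wilson_hypE n :
  wilson_hyp n = wilson_factor a * (wilson_num n / wilson_den n).
Proof.
rewrite /wilson_hyp /wilson_den big_nat_recl // addr0 big_mkord.
set P := \prod_(_ < n) _.
have uP : P \is a GRing.unit by apply: rpred_prod => l _; exact: wilson_factor_unit.
rewrite !invrM ?unitrM ?fpsC_unit ?wilson_factor_unit ?pochhammer_neq0 //.
by rewrite -[LHS]mul1r -(divrr (wilson_factor_unit a)); ring.
Qed.

(** The power of sqrt t clears the denominators t introduced by each of the n
    pairs of conjugate factors; the same power comes from the numerator. *)
Lemma conjugate_pochhammer (i : F) n : i ^+ 2 = -1 ->
  laurentX F ^+ n.*2
    * (pochhammer (laurentC a + 1 + laurentC i / laurentX F) n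
       * pochhammer (laurentC a + 1 - laurentC i / laurentX F) n)
  = laurent_sq (\prod_(l < n) wilson_factor (a + l.+1%:R)).
Proof.
move=> i2; have x0 := laurentX_neq0 F.
rewrite rmorph_prod -big_split -mul2n exprM.
rewrite -[X in _ ^+ X](card_ord n) -prodr_const -big_split; apply: eq_bigr => l _ /=.
rewrite /wilson_factor rmorphD rmorph1 rmorphM /= laurent_sqC laurent_sqX.
have j2 : laurentC i ^+ 2 = -1 by rewrite -rmorphXn i2 rmorphN1.
rewrite rmorphXn rmorphD rmorph_nat /= -nat1r.
rewrite (addrAC _ (_ / _)) (addrAC _ (- (_ / _))) conjugate_factors //.
by rewrite addrA.
Qed.

Lemma wilson_hyp_hypergeom (i : F) n : i ^+ 2 = -1 -> n`!%:R != 0 :> F ->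
  laurent_sq (wilson_hyp n) =
  hypergeom_term [:: laurentC (a + b); laurentC (a + c); laurentC (a + d); 1]
    [:: laurentC s; laurentC a + 1 + laurentC i / laurentX F;
        laurentC a + 1 - laurentC i / laurentX F] 1 n.
Proof.
move=> i2 n0; rewrite /hypergeom_term !big_cons !big_nil !mulr1 expr1n pochhammer1.
have x0 := laurentX_neq0 F.
have ps0 : pochhammer s n != 0 by exact: pochhammer_neq0.
have uP : \prod_(l < n) wilson_factor (a + l.+1%:R) \is a GRing.unit.
  by apply: rpred_prod => l _; exact: wilson_factor_unit.
have conj := conjugate_pochhammer n i2.
have P0 : laurent_sq (\prod_(l < n) wilson_factor (a + l.+1%:R)) != 0.
  by rewrite -unitfE rmorph_unit.
rewrite rmorph_div ?unitrM ?fpsC_unit //= !rmorphM /= rmorphXn /=.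
rewrite !laurent_sqC laurent_sqX -exprM mul2n -conj.
move: P0; rewrite -conj mulf_eq0 negb_or => /andP[X0 pp0].
rewrite -!(rmorph_pochhammer (@laurentC F)) /=.
have lps0 : laurentC (pochhammer s n) != 0 by rewrite fmorph_eq0.
have ln0 : n`!%:R != 0 :> laurent F.
  by rewrite -(rmorph_nat (@laurentC F)) fmorph_eq0.
have cancel (L : fieldType) (x y z X S P N : L) :
    X != 0 -> S != 0 -> P != 0 -> N != 0 ->
    x * y * z * X / (S * (X * P)) = x * (y * (z * N)) / (S * P) * (1 / N).
  by move=> X0' S0 P0 N0; field; rewrite X0' S0 P0 N0.
by rewrite (cancel _ _ _ _ _ _ _ n`!%:R).
Qed.
End WilsonSeries.

(** * Moments as rational functions *)

Section WilsonShift.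
Variable C : fieldType.
Local Notation v := [tuple Wa C + 1; Wb C; Wc C; Wd C].

Lemma wilson_shift_neq0 (p : {mpoly C[4]}) :
  p != 0 -> mmap (@ratfun_const C 4) (tnth v) p != 0.
Proof.
apply: (@translation_subst_neq0 _ _ (fun i => (i == inord 0)%:R)) => i.
have inord_val (k : nat) (k4 : (k < 4)%N) : inord k = Ordinal k4.
  by apply: val_inj; rewrite /= inordK.
by case: i => -[|[|[|[|//]]]] i4; rewrite (tnth_nth 0) -inord_val /=
  -val_eqE /= !inordK //= ?rmorph1 ?rmorph0 ?addr0.
Qed.

HB.instance Definition _ := GRing.isZmodMorphism.Build _ _ (ratfun_subst v)
  (ratfun_subst_zmod_morphism wilson_shift_neq0).
HB.instance Definition _ := GRing.isMonoidMorphism.Build _ _ (ratfun_subst v)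
  (ratfun_subst_monoid_morphism wilson_shift_neq0).

Lemma wilson_shift_var (k : nat) : (k < 4)%N ->
  ratfun_subst v (ratfun_var C (inord k)) = nth 0 v k.
Proof.
by move=> k4; rewrite (ratfun_subst_var wilson_shift_neq0) (tnth_nth 0) inordK.
Qed.

Lemma wilson_sum_neq0 (l : nat) : Wa C + Wb C + Wc C + Wd C + l%:R != 0.
Proof.
rewrite -(rmorph_nat (@FracField.tofrac {mpoly C[4]})) -!rmorphD tofrac_eq0.
(* The polynomial takes the value 1 at the point (1 - l, 0, 0, 0). *)
apply/eqP => /(congr1 (meval (fun i => if i == inord 0 then 1 - l%:R else 0))).
rewrite !rmorphD rmorph_nat rmorph0 /= !mevalXU -!val_eqE /= !inordK //=.
by rewrite !addr0 subrK => /eqP; rewrite oner_eq0.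
Qed.

End WilsonShift.

Theorem proposition1 (C : numClosedFieldType) :
  let F := ratfun C 4 in
  let a : F := Wa C in
  let b : F := Wb C in
  let c : F := Wc C in
  let d : F := Wd C in
  let W : fps F := Fps (wilson_moment C) in
  let i : laurent F := laurentC (ratfun_const 4 ('i : C)) in
  let sqrt_t : laurent F := laurentX F in
  fps_has_sum
    (fun n =>
       fpsC (pochhammer (a + b) n * pochhammer (a + c) n * pochhammer (a + d) n)
         * 't ^+ n
       / (fpsC (pochhammer (a + b + c + d) n)
            * \prod_(0 <= l < n.+1) (1 + fpsC ((a + l%:R) ^+ 2) * 't)))
    W
  /\
  exists (h : nat -> fps F) (H : fps F),
    [/\ forall n, laurent_sq (h n) =
          hypergeom_term
            [:: laurentC (a + b); laurentC (a + c); laurentC (a + d); 1]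
            [:: laurentC (a + b + c + d);
                laurentC a + 1 + i / sqrt_t;
                laurentC a + 1 - i / sqrt_t] 1 n,
        forall n, exists g, h n = 't ^+ n * g,
        fps_has_sum h H
      & W = (1 + fpsC (a ^+ 2) * 't)^-1 * H].
Proof.
move=> F a b c d W i sqrt_t.
have s_neq0 l : a + b + c + d + l%:R != 0 by exact: wilson_sum_neq0.
have remainder := @wilson_gf_remainder F a b c d s_neq0
  (ratfun_subst [tuple Wa C + 1; Wb C; Wc C; Wd C])
  (@wilson_shift_var C 0 isT) (@wilson_shift_var C 1 isT)
  (@wilson_shift_var C 2 isT) (@wilson_shift_var C 3 isT)
  (wilson_moment C) erefl (fun=> erefl).
split; first exact: fps_has_sum_dvd.
exists (wilson_hyp a b c d), (wilson_factor a * W); split=> [n|n||].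
- apply: wilson_hyp_hypergeom => //.
    by rewrite -rmorphXn Num.Theory.sqrCi rmorphN1.
  rewrite -(rmorph_nat (@ratfun_const C 4)) fmorph_eq0.
  by rewrite Num.Theory.pnatr_eq0 -lt0n fact_gt0.
- exact: wilson_hyp_dvd.
- apply: fps_has_sum_dvd => m; have [g remE] := remainder m.
  exists (wilson_factor a * g); rewrite mulrCA -remE mulrBr mulr_sumr.
  by congr (_ - _); apply: eq_bigr => n _; exact: wilson_hypE.
- by rewrite mulKr ?wilson_factor_unit.
Qed.
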